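(* Let $K$ be an ordered field that is a finite algebraic extension of the field $\mathbb{Q}$ of rational numbers. Then there exist positive integers $n,m$ and a matrix $A\in K^{n\times m}$ of rank $n-3$ with the following property: for any matrix $A'\in K^{n\times m}$ which has the same rank and the same sign pattern as $A$, the entries of $A'$ generate the whole field $K$ (that is, the smallest subfield of $K$ containing all entries of $A'$ is $K$).
   Context: A field $R$ is ordered if it is equipped with a subset $P\subset R$, closed under addition and multiplication, such that $P$, $-P$ and $\{0\}$ form a partition of $R$; elements of $P$ are called positive and those of $-P$ negative. The sign pattern of a matrix $A\in R^{m\times n}$ over an ordered field $R$ is the matrix $S\in\{+,-,0\}^{m\times n}$ with $S_{ij}=+$ if $A_{ij}$ is positive, $S_{ij}=-$ if $A_{ij}$ is negative, and $S_{ij}=0$ if $A_{ij}=0$. *)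

(* Defs.v *)
From HB Require Import structures.
From mathcomp Require Import all_boot all_order all_algebra all_field.

Set Implicit Arguments.
Unset Strict Implicit.
Unset Printing Implicit Defensive.

Import GRing.Theory.
Local Open Scope ring_scope.

(* The last clause says that exactly one of x \in P, x \in - P, x = 0 holds,
   i.e. that P, - P and {0} partition R; booleans are added as naturals. *)
Definition is_positive_cone (R : fieldType) (P : {pred R}) : Prop :=
  [/\ {in P &, forall x y, x + y \in P},
      {in P &, forall x y, x * y \in P}
    & forall x : R, ((x \in P) + (- x \in P)%R + (x == 0)%R)%N = 1%N].

Inductive sign : Type := Plus | Minus | Zero.

Definition sign_of (R : fieldType) (P : {pred R}) (x : R) : sign :=
  if x \in P then Plus else if - x \in P then Minus else Zero.

Definition sign_pattern (R : fieldType) (P : {pred R}) (m n : nat)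
    (A : 'M[R]_(m, n)) : 'M[sign]_(m, n) :=
  map_mx (sign_of P) A.

(* A subset of a field is a subfield iff it is [divring_closed]: it contains 1
   and is closed under subtraction and division (where x / 0 = 0). *)
Definition entries_generate (R : fieldType) (m n : nat)
    (A : 'M[R]_(m, n)) : Prop :=
  forall S : {pred R}, divring_closed S ->
    (forall i j, A i j \in S) -> forall x : R, x \in S.

(* Main.v *)
Require Import Defs.
From HB Require Import structures.
From mathcomp Require Import all_boot all_order all_algebra all_field.
From mathcomp Require Import ring.

(** The columns of A list the linear dependencies of a planar point
    configuration, and the configuration is rich enough to remember the field
    K. The sign pattern enters through the zeros of A, which say which points
    are collinear.

    Given n vectors of K^3 that span it, Cramer's rule writes down a dependency
    for any four of them, and these dependencies form a matrix A of rank n - 3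
    ([rank_circuits]). Let A' have the same zeros and the same rank. Its left
    kernel has dimension 3, so it assigns to the i-th index the i-th coordinate
    of its vectors, that is, a vector of the dual of the kernel: a second
    configuration of n vectors in 3-space. It has the bases of the first one
    ([kernel_basis], [kernel_interpolation]), and three points that were
    collinear remain so, with coefficients that are quotients of entries of A'
    ([kernel_line]).

    For the configuration, take the points (x, y, 1) with x and y in a finite
    subset T of K, together with three points at infinity. By von Staudt's
    constructions the collinearities in this grid encode the sums and products
    that stay in T, so the second configuration carries a map phi on T that
    respects them ([realization_morphism]). As a cross-ratio, phi x is a
    quotient of products of entries of A'.

    Finally let a generate K over the rationals, with minimal polynomial f. If T
    holds all the intermediate results of an evaluation of f at a, including
    those by which its rational coefficients are obtained from 1, then
    f (phi a) = phi (f a) = 0 ([forced_minPoly]). So phi a is a conjugate of a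
    inside K; its degree is that of K, and it generates K
    ([divring_closed_full]). Every subfield that contains the entries of A'
    contains phi a, hence is K. *)

Set Implicit Arguments.
Unset Strict Implicit.
Unset Printing Implicit Defensive.

Import GRing.Theory.
Local Open Scope ring_scope.

(** * Maps that respect the arithmetic of a finite set *)

Definition partial_morphism (K : fieldType) (T : seq K) (phi : K -> K) : Prop :=
  [/\ phi 1 = 1,
      {in T &, forall x y, x + y \in T -> phi (x + y) = phi x + phi y}
    & {in T &, forall x y, x * y \in T -> phi (x * y) = phi x * phi y}].

Lemma partial_morphismW (K : fieldType) (T U : seq K) (phi : K -> K) :
  {subset T <= U} -> partial_morphism U phi -> partial_morphism T phi.
Proof.
move=> sTU [phi1 phiD phiM]; split=> // x y /sTU Ux /sTU Uy /sTU Uxy.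
  exact: phiD.
exact: phiM.
Qed.

(** The value at [x] of a map that respects enough sums and products is the
    value of [v] at the image of [a]. The finite set is existentially
    quantified so that the rules below need not name the intermediate results
    that they add to it. *)
Definition forced (K : fieldType) (a x : K) (v : K -> K) : Prop :=
  exists T : seq K, forall phi, partial_morphism T phi -> phi x = v (phi a).

Section Forced.

Variables (K : fieldType) (a : K).

Lemma forced_gen : forced a a id.
Proof. by exists [::]. Qed.

Lemma forced1 : forced a 1 (fun=> 1).
Proof. by exists [::] => phi []. Qed.

Lemma forcedD x y v w :
  forced a x v -> forced a y w -> forced a (x + y) (fun b => v b + w b).
Proof.
move=> [T phiT] [U phiU]; exists (T ++ U ++ [:: x; y; x + y]) => phi mphi.
rewrite -phiT -?phiU; first 1 last.
- by apply: partial_morphismW mphi => z Uz; rewrite !mem_cat Uz orbT.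
- by apply: partial_morphismW mphi => z Tz; rewrite mem_cat Tz.
by case: mphi => _ phiD _; rewrite phiD // !mem_cat !inE eqxx ?orbT.
Qed.

Lemma forcedM x y v w :
  forced a x v -> forced a y w -> forced a (x * y) (fun b => v b * w b).
Proof.
move=> [T phiT] [U phiU]; exists (T ++ U ++ [:: x; y; x * y]) => phi mphi.
rewrite -phiT -?phiU; first 1 last.
- by apply: partial_morphismW mphi => z Uz; rewrite !mem_cat Uz orbT.
- by apply: partial_morphismW mphi => z Tz; rewrite mem_cat Tz.
by case: mphi => _ _ phiM; rewrite phiM // !mem_cat !inE eqxx ?orbT.
Qed.

Lemma forced0 : forced a 0 (fun=> 0).
Proof.
exists [:: 0] => phi [_ phiD _]; apply: (addrI (phi 0)).
by rewrite -phiD ?addr0 ?inE.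
Qed.

Lemma forcedN x v : forced a x v -> forced a (- x) (fun b => - v b).
Proof.
move=> [T phiT]; have [U phi0] := forced0.
exists (T ++ U ++ [:: x; - x; x - x]) => phi mphi.
rewrite -phiT; last first.
  by apply: partial_morphismW mphi => z Tz; rewrite mem_cat Tz.
have phi00 : phi 0 = 0.
  apply: phi0; apply: partial_morphismW mphi => z Uz.
  by rewrite !mem_cat Uz orbT.
case: mphi => _ phiD _; apply: (addrI (phi x)).
by rewrite -phiD ?subrr ?phi00 // !mem_cat !inE ?subrr eqxx ?orbT.
Qed.

Lemma forced_nat n : forced a n%:R (fun=> n%:R).
Proof.
elim: n => [|n IHn]; first exact: forced0.
by rewrite mulrS; apply: forcedD => //; apply: forced1.
Qed.

Lemma forced_int (z : int) : forced a z%:~R (fun=> z%:~R).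
Proof.
case: z => n; first exact: forced_nat.
by rewrite NegzE mulrNz; apply: forcedN; apply: forced_nat.
Qed.

(** Maps that respect products respect the quotients by elements that they
    fix. This gives the rationals from the integers. *)
Lemma forced_div (x y c : K) :
  c != 0 -> forced a c (fun=> c) -> forced a (x * c) (fun=> y * c) ->
  forced a x (fun=> y).
Proof.
move=> c0 [T phiT] [U phiU]; exists (T ++ U ++ [:: x; c; x * c]) => phi mphi.
have phic : phi c = c.
  by apply: phiT; apply: partial_morphismW mphi => z Tz; rewrite mem_cat Tz.
have : phi (x * c) = y * c.
  apply: phiU; apply: partial_morphismW mphi => z Uz.
  by rewrite !mem_cat Uz orbT.
case: mphi => _ _ phiM; rewrite phiM ?phic //; first exact: mulIf.
all: by rewrite !mem_cat !inE eqxx ?orbT.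
Qed.

End Forced.

Lemma alg_rat (K : fieldExtType rat) (q : rat) :
  q%:A * (denq q)%:~R = (numq q)%:~R :> K.
Proof.
by rewrite mulr_algl -scaler_int scalerA -numqE scaler_int.
Qed.

Lemma intr_neq0 (K : fieldExtType rat) (z : int) : z != 0 -> z%:~R != 0 :> K.
Proof.
move=> z0; rewrite -[_%:~R]scaler_int scaler_eq0 intr_eq0 negb_or z0.
exact: oner_neq0.
Qed.

Lemma forced_rat (K : fieldExtType rat) (a : K) (q : rat) :
  forced a q%:A (fun=> q%:A).
Proof.
apply: (@forced_div _ _ _ _ (denq q)%:~R).
- by rewrite intr_neq0 ?denq_neq0.
- exact: forced_int.
by rewrite alg_rat; apply: forced_int.
Qed.

Lemma forced_horner (K : fieldExtType rat) (a : K) (g : {poly K}) :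
  g \is a polyOver 1%VS -> forced a g.[a] (horner g).
Proof.
case/polyOver1P=> {}g ->.
elim/poly_ind: g => [|g c IHg].
  have [T phi0] := forced0 a; exists T => phi /phi0.
  by rewrite rmorph0 !horner0.
rewrite rmorphD rmorphM /= map_polyX map_polyC /=.
have [T phiT] := forcedD (forcedM IHg (forced_gen a)) (forced_rat a c).
by exists T => phi /phiT; rewrite !hornerE.
Qed.

Lemma forced_minPoly (K : fieldExtType rat) (a : K) :
  exists T : seq K, forall phi,
    partial_morphism T phi -> root (minPoly 1 a) (phi a).
Proof.
have [T phi0] := forced0 a.
have [U phiU] := @forced_horner _ a _ (minPolyOver 1 a).
exists (T ++ U) => phi mphi; apply/rootP.
rewrite -phiU; last first.
  by apply: partial_morphismW mphi => z; rewrite mem_cat orbC => ->.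
rewrite (rootP (root_minPoly 1 a)) phi0 //.
by apply: partial_morphismW mphi => z; rewrite mem_cat => ->.
Qed.

(** * A conjugate of a primitive element is primitive *)

Lemma primitive_element (K : fieldExtType rat) :
  exists a : K, <<1; a>>%VS = fullv.
Proof.
exists (separable_generator 1 {:K}).
rewrite -eq_adjoin_separable_generator ?sub1v //.
apply/separableP=> y _; apply: pcharf0_separable => p.
by rewrite pchar_lalg Num.Theory.pchar_num.
Qed.

(** By irreducibility [b] has the same minimal polynomial as [a], so it
    generates a subspace of full dimension, whose elements are the values at
    [b] of the rational polynomials. *)
Lemma divring_closed_full (K : fieldExtType rat) (a b : K) (S : {pred K}) :
  divring_closed S -> <<1; a>>%VS = fullv -> b \in S -> root (minPoly 1 a) b ->
  forall x, x \in S.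
Proof.
move=> Sdiv genA Sb rootb x.
pose S' : divringClosed K := HB.pack S (GRing.isDivringClosed.Build K S Sdiv).
have same : minPoly 1 b %= minPoly 1 a.
  have /minPoly_irr/orP[] // := minPoly_dvdp (minPolyOver 1 a) rootb.
    exact: minPolyOver.
  by rewrite -size_poly_eq1 size_minPoly.
have genB : <<1; b>>%VS = fullv.
  apply/eqP; rewrite eqEdim subvf -genA !dim_Fadjoin.
  have := eqp_size same; rewrite !size_minPoly => /eqP.
  by rewrite eqSS => /eqP ->; rewrite leqnn.
have /Fadjoin_polyP[g /polyOver1P[{}g ->] ->] : x \in <<1; b>>%VS.
  by rewrite genB memvf.
rewrite -[S]/(S' : {pred K}).
apply: rpred_horner => //; apply/polyOverP=> i; rewrite coef_map /=.
rewrite (canRL (mulfK _) (alg_rat K _)) ?intr_neq0 ?denq_neq0 //.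
exact: (rpred_div (rpred_int S' _) (rpred_int S' _)).
Qed.

(** * The matrix of dependencies of a point configuration *)

Section Bracket.
Variables (K : fieldType) (n : nat) (p : 'M[K]_(n, 3)).

(** The 3 x 3 determinant with rows [u], [v] and [w], expanded so that [ring]
    computes with it. *)
Definition bracket (u v w : 'rV[K]_3) : K :=
  let: o := ord0 in let: i := lift ord0 ord0 in let: t := ord_max in
  u 0 o * (v 0 i * w 0 t - v 0 t * w 0 i)
  - u 0 i * (v 0 o * w 0 t - v 0 t * w 0 o)
  + u 0 t * (v 0 o * w 0 i - v 0 i * w 0 o).

Definition chi (a b c : 'I_n) := bracket (row a p) (row b p) (row c p).

Lemma ord3P (Q : 'I_3 -> Prop) :
  Q ord0 -> Q (lift ord0 ord0) -> Q ord_max -> forall k, Q k.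
Proof.
move=> Q0 Q1 Q2 [[|[|[|//]]] lt].
- by rewrite (_ : Ordinal lt = ord0) //; apply: val_inj.
- by rewrite (_ : Ordinal lt = lift ord0 ord0) //; apply: val_inj.
- by rewrite (_ : Ordinal lt = ord_max) //; apply: val_inj.
Qed.

(** The expansion of a vanishing 4 x 4 determinant, two rows of which are the
    same coordinate of the four vectors. *)
Lemma cramer (u v w z : 'rV[K]_3) :
  bracket v w z *: u - bracket u w z *: v + bracket u v z *: w
  - bracket u v w *: z = 0.
Proof.
by apply/rowP; apply: ord3P; rewrite !mxE /bracket; ring.
Qed.

(** The column of index (a, b, c, d) is Cramer's dependency between the rows
    a, b, c and d of [p]. When two of these indices are equal, its terms
    cancel and the column vanishes. *)
Definition circuits :
    'M[K]_(n, #|{: 'I_n * 'I_n * 'I_n * 'I_n}|) :=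
  \matrix_(i, j) let: (a, b, c, d) := enum_val j in
    (i == a)%:R * chi b c d - (i == b)%:R * chi a c d
    + (i == c)%:R * chi a b d - (i == d)%:R * chi a b c.

Definition same_zeros (m : nat) (A B : 'M[K]_(n, m)) : Prop :=
  forall i j, (B i j == 0) = (A i j == 0).

Definition circuit_index (a b c d : 'I_n) := enum_rank (a, b, c, d).

Lemma circuitsE i a b c d :
  circuits i (circuit_index a b c d) =
    (i == a)%:R * chi b c d - (i == b)%:R * chi a c d
    + (i == c)%:R * chi a b d - (i == d)%:R * chi a b c.
Proof. by rewrite mxE enum_rankK. Qed.

Lemma trmx_circuits : p^T *m circuits = 0.
Proof.
apply/matrixP=> k j; rewrite -[j]enum_valK; case: (enum_val j) => [[[a b] c] d].
rewrite mxE [RHS]mxE.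
have := congr1 (fun u : 'rV[K]_3 => u 0 k)
  (cramer (row a p) (row b p) (row c p) (row d p)).
rewrite !mxE -!/(chi _ _ _); apply: etrans.
have pick (e : 'I_n) (y : K) : \sum_i p i k * ((i == e)%:R * y) = y * p e k.
  rewrite (bigD1 e) //= eqxx mul1r big1 ?addr0 1?mulrC // => i /negPf ->.
  by rewrite mul0r mulr0.
under eq_bigr => i _ do rewrite mxE circuitsE mulrBr mulrDr mulrBr.
by rewrite sumrB big_split sumrB /= !pick.
Qed.

Variable B : 'M[K]_(n, #|{: 'I_n * 'I_n * 'I_n * 'I_n}|).
Hypothesis zerosB : same_zeros circuits B.

(** For an index d outside the basis a, b, c, the column (a, b, c, d) of [B]
    has a nonzero entry at d and all its other nonzero entries at a, b, c, so
    it determines the coordinate d from the other three. *)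
Lemma kernel_basis (x : 'rV[K]_n) a b c :
  x *m B = 0 -> chi a b c != 0 -> x 0 a = 0 -> x 0 b = 0 -> x 0 c = 0 -> x = 0.
Proof.
move=> xB abc xa xb xc; apply/rowP=> d; rewrite mxE.
have [-> //|da] := eqVneq d a; have [-> //|db] := eqVneq d b.
have [-> //|dc] := eqVneq d c.
have := congr1 (fun u : 'rV[K]_#|_| => u 0 (circuit_index a b c d)) xB.
rewrite !mxE (bigD1 d) //= big1 ?addr0 => [/eqP|i id].
  rewrite mulf_eq0 zerosB circuitsE eqxx (negPf da) (negPf db) (negPf dc).
  by rewrite !mul0r subr0 addr0 sub0r mul1r oppr_eq0 (negPf abc) orbF => /eqP.
have [->|ia] := eqVneq i a; first by rewrite xa mul0r.
have [->|ib] := eqVneq i b; first by rewrite xb mul0r.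
have [->|ic] := eqVneq i c; first by rewrite xc mul0r.
apply/eqP; rewrite mulf_eq0 zerosB circuitsE.
rewrite (negPf ia) (negPf ib) (negPf ic) (negPf id).
by rewrite !mul0r !subr0 addr0 eqxx orbT.
Qed.


(** As a, b, c are collinear, the column (a, b, c, d) vanishes at d, and it
    does not vanish at c because a, b, d is a basis. So the column expresses
    the coordinate c by the coordinates a and b, in the same way for all the
    vectors of the kernel. *)
Lemma kernel_line (S : {pred K}) a b c d :
    divring_closed S -> (forall i j, B i j \in S) ->
    chi a b d != 0 -> chi a b c = 0 ->
  exists l m, [/\ l \in S, m \in S &
    forall x : 'rV[K]_n, x *m B = 0 -> x 0 c = l * x 0 a + m * x 0 b].
Proof.
move=> Sdiv SB abd abc.
pose S' : divringClosed K := HB.pack S (GRing.isDivringClosed.Build K S Sdiv).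
have [->|ca] := eqVneq c a.
  exists 1, 0; split=> [||x _]; last by rewrite mul1r mul0r addr0.
    exact: (rpred1 S').
  exact: (rpred0 S').
have [->|cb] := eqVneq c b.
  exists 0, 1; split=> [||x _]; last by rewrite mul1r mul0r add0r.
    exact: (rpred0 S').
  exact: (rpred1 S').
have chi_aa u : chi a a u = 0 by rewrite /chi /bracket; ring.
have ab : b != a by apply: contraNneq abd => ->; rewrite chi_aa.
pose j := circuit_index a b c d.
have cd : c != d by apply: contraNneq abd => <-; rewrite abc.
have Bc : B c j != 0.
  rewrite zerosB circuitsE (negPf ca) (negPf cb) eqxx (negPf cd).
  by rewrite !mul0r !subr0 add0r mul1r.
exists (- (B a j / B c j)), (- (B b j / B c j)); split=> [||x xB].
- exact: (rpredNr (rpred_div (SB a j : _ \in S') (SB c j : _ \in S'))).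
- exact: (rpredNr (rpred_div (SB b j : _ \in S') (SB c j : _ \in S'))).
have := congr1 (fun u : 'rV[K]_#|_| => u 0 j) xB.
rewrite !mxE (bigD1 c) //= (bigD1 a) 1?eq_sym //= (bigD1 b) /=; last first.
  by rewrite ab eq_sym cb.
rewrite big1 => [dep|i /andP[/andP[ic ia] ib]].
  apply: (mulIf Bc); apply/eqP; rewrite -subr_eq0 -{}dep; apply/eqP.
  by field.
apply/eqP; rewrite mulf_eq0 zerosB circuitsE abc.
by rewrite (negPf ia) (negPf ib) (negPf ic) !mul0r mulr0 !subr0 addr0 eqxx orbT.
Qed.

(** Right multiplication by this matrix selects the coordinates a, b, c of row
    vectors of length n. *)
Definition coordinates (a b c : 'I_n) : 'M[K]_(n, 3) :=
  \matrix_(i, k) (i == nth a [:: a; b; c] k)%:R.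

Lemma mul_coordinates m (x : 'M[K]_(m, n)) a b c r k :
  (x *m coordinates a b c) r k = x r (nth a [:: a; b; c] k).
Proof.
rewrite mxE (bigD1 (nth a [:: a; b; c] k)) //= mxE eqxx mulr1 big1 ?addr0 //.
by move=> i /negPf ik; rewrite mxE ik mulr0.
Qed.

Lemma rank_kernel_coordinates a b c :
  chi a b c != 0 ->
  \rank (kermx B *m coordinates a b c) = \rank (kermx B).
Proof.
move=> abc; rewrite -[RHS](mxrank_mul_ker _ (coordinates a b c)).
suff -> : (kermx B :&: kermx (coordinates a b c) = 0)%MS.
  by rewrite mxrank0 addn0.
apply/eqP/rowV0P => x; rewrite sub_capmx.
move=> /andP[/sub_kermxP xB /sub_kermxP x0].
have xk (k : 'I_3) : x 0 (nth a [:: a; b; c] k) = 0.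
  by rewrite -mul_coordinates x0 mxE.
exact: (kernel_basis xB abc (xk ord0) (xk (lift ord0 ord0)) (xk ord_max)).
Qed.

(** The kernel has dimension 3 and embeds into the space of the coordinates
    a, b, c, which it therefore fills. *)
Lemma kernel_interpolation a b c (y : 'rV[K]_3) :
  (\rank B + 3)%N = n -> chi a b c != 0 ->
  exists2 x : 'rV[K]_n, x *m B = 0 &
    forall k : 'I_3, x 0 (nth a [:: a; b; c] k) = y 0 k.
Proof.
move=> rkB abc.
have full : row_full (kermx B *m coordinates a b c).
  by rewrite /row_full rank_kernel_coordinates // mxrank_ker -{1}rkB addKn.
have /submxP[z ->] := submx_full y full.
exists (z *m kermx B) => [|k]; first by rewrite -mulmxA mulmx_ker mulmx0.
by rewrite mulmxA mul_coordinates.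
Qed.

End Bracket.

(** The left kernel of the dependency matrix contains the three coordinate
    functions of the points, which are independent because some bracket is
    nonzero, and it embeds into K^3 by [kernel_basis]. *)
Lemma rank_circuits (K : fieldType) n (p : 'M[K]_(n, 3)) a b c :
  chi p a b c != 0 -> (\rank (circuits p) + 3)%N = n.
Proof.
move=> abc; have zeros : same_zeros (circuits p) (circuits p) by [].
have le3 := rank_leq_col (kermx (circuits p) *m coordinates K a b c).
rewrite (rank_kernel_coordinates zeros) // mxrank_ker in le3.
have free : row_free p^T.
  rewrite -kermx_eq0; apply/rowV0P => w /sub_kermxP wp.
  have w_row e : row e p *m w^T = 0.
    by rewrite -row_mul -[p]trmxK -trmx_mul wp trmx0 row0.
  (* w annihilates the three rows, and Cramer's rule expresses each standard
     basis vector by them. *)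
  apply/rowP=> k; rewrite [RHS]mxE; apply: (mulfI abc); rewrite mulr0.
  have := congr1 (fun u : 'rV[K]_3 => u *m w^T)
    (cramer (row a p) (row b p) (row c p) (delta_mx 0 k)).
  rewrite mulmxBl mulmxDl mulmxBl -!scalemxAl !w_row !scaler0 mul0mx.
  rewrite subr0 addr0 sub0r -rowE => /matrixP/(_ 0 0)/eqP.
  by rewrite !mxE oppr_eq0 => /eqP.
have ge3 : (3 <= n - \rank (circuits p))%N.
  rewrite -mxrank_ker -{1}(eqP free) mxrankS //.
  by apply/sub_kermxP; apply: trmx_circuits.
have /eqP rk : (n - \rank (circuits p) == 3)%N by rewrite eqn_leq le3 ge3.
by rewrite -{1}rk subnKC // rank_leq_row.
Qed.

(** * The arithmetic encoded by a grid of points *)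

Definition pt (K : fieldType) (x y z : K) : 'rV[K]_3 :=
  \row_k nth 0 [:: x; y; z] k.

Lemma bracket_pt (K : fieldType) (a b c a' b' c' a'' b'' c'' : K) :
  bracket (pt a b c) (pt a' b' c') (pt a'' b'' c'') =
    a * (b' * c'' - c' * b'') - b * (a' * c'' - c' * a'')
    + c * (a' * b'' - b' * a'').
Proof. by rewrite /bracket !mxE. Qed.

(** The first three points lie on the line at infinity: the directions of the
    two axes and of the diagonal. The third point of the projective frame, the
    origin, and its unit point belong to the affine part as soon as 0 and 1
    are in [T]. *)
Definition grid (K : fieldType) (T : seq K) : seq 'rV[K]_3 :=
  [:: pt 1 0 0, pt 0 1 0, pt 1 1 0 & [seq pt x y 1 | x <- T, y <- T]].

Lemma mem_grid (K : fieldType) (T : seq K) x y :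
  x \in T -> y \in T -> pt x y 1 \in grid T.
Proof.
by move=> Tx Ty; rewrite !inE (allpairs_f (fun x y => pt x y 1)) ?orbT.
Qed.

(** [C] plays the part of the linear functions of a second configuration in
    3-space, indexed by the points of [Q]; a function is known by its values
    at the indices. The clauses say that collinearities of [Q] persist, with
    coefficients in [S], and that bases of [Q] remain bases. No coordinates
    are chosen, so that a projective frame can be put in normal form by
    choosing three functions. *)
Definition realization (K : fieldType) (S : {pred K}) (Q : seq 'rV[K]_3)
    (C : ('rV[K]_3 -> K) -> Prop) : Prop :=
  [/\ forall u v w z, u \in Q -> v \in Q -> w \in Q -> z \in Q ->
        bracket u v z != 0 -> bracket u v w = 0 ->
        exists l m, [/\ l \in S, m \in S
          & forall f, C f -> f w = l * f u + m * f v],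
      forall u v w, u \in Q -> v \in Q -> w \in Q -> bracket u v w != 0 ->
        forall f, C f -> f u = 0 -> f v = 0 -> f w = 0 ->
        forall q, q \in Q -> f q = 0
    & forall u v w, u \in Q -> v \in Q -> w \in Q -> bracket u v w != 0 ->
        forall a b c, exists f, [/\ C f, f u = a, f v = b & f w = c]].

(** Choose the homogeneous coordinates X, Y, Z of the second configuration in
    which the frame is in standard position up to scaling. Then phi x is the
    abscissa X / Z of the image of (x, 0, 1). Horizontal and vertical lines and
    the diagonal show that (x, y, 1) goes to the affine point (phi x, phi y);
    lines of slope 1 turn this into additivity and lines through the origin
    into multiplicativity. *)
Lemma realization_morphism (K : fieldType) (S : {pred K}) (T : seq K)
    (C : ('rV[K]_3 -> K) -> Prop) :
  divring_closed S -> 0 \in T -> 1 \in T -> realization S (grid T) C ->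
  exists2 phi, partial_morphism T phi & {in T, forall x, phi x \in S}.
Proof.
move=> Sdiv T0 T1 [line basis interp].
pose S' : divringClosed K := HB.pack S (GRing.isDivringClosed.Build K S Sdiv).
pose e1 := pt 1 0 0 : 'rV[K]_3; pose e2 := pt 0 1 0 : 'rV[K]_3.
pose d := pt 1 1 0 : 'rV[K]_3; pose P x y := pt x y 1 : 'rV[K]_3.
have [Q1 Q2 Qd] : [/\ e1 \in grid T, e2 \in grid T & d \in grid T].
  by rewrite !inE !eqxx !orbT.
have QP x y : x \in T -> y \in T -> P x y \in grid T.
  exact: mem_grid.
have [Qo Qu] := (QP 0 0 T0 T0, QP 1 1 T1 T1).
have brE := @bracket_pt K.
(* All the brackets of noncollinear points below are 1 or -1, and ring proves
   that their squares are 1. *)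
have ne (k : K) : k ^+ 2 = 1 -> k != 0.
  by move=> k2; rewrite -sqrf_eq0 k2 oner_eq0.
have frame u v w : u \in grid T -> v \in grid T -> w \in grid T ->
    bracket u v w ^+ 2 = 1 -> forall a b c,
    exists f, [/\ C f, f u = a, f v = b & f w = c].
  by move=> Qu' Qv Qw /ne; apply: interp.
have [|X [CX Xu X2 Xo]] := frame _ _ _ Qu Q2 Qo _ 1 0 0.
  by rewrite brE; ring.
have [|Y [CY Y1 Yu Yo]] := frame _ _ _ Q1 Qu Qo _ 0 1 0.
  by rewrite brE; ring.
have [|Z [CZ Z1 Z2 Zu]] := frame _ _ _ Q1 Q2 Qu _ 0 0 1.
  by rewrite brE; ring.
have ZP x y : x \in T -> y \in T -> Z (P x y) != 0.
  move=> Tx Ty; apply/eqP => ZP0; have/eqP := oner_eq0 K; rewrite -Zu; case.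
  apply: (basis _ _ _ Q1 Q2 (QP _ _ Tx Ty)) CZ Z1 Z2 ZP0 _ Qu.
  by apply: ne; rewrite brE; ring.
pose phi x := X (P x 0) / Z (P x 0).
have on_line z u v w :
    u \in grid T -> v \in grid T -> w \in grid T -> z \in grid T ->
    bracket u v z ^+ 2 = 1 -> bracket u v w = 0 ->
    exists l m, [/\ l \in S, m \in S, X w = l * X u + m * X v,
      Y w = l * Y u + m * Y v & Z w = l * Z u + m * Z v].
  move=> Qu' Qv Qw Qz /ne uvz /(line _ _ _ _ Qu' Qv Qw Qz uvz).
  move=> [l [m [Sl Sm f]]].
  by exists l, m; split=> //; apply: f.
have XP x y : x \in T -> y \in T -> X (P x y) = phi x * Z (P x y).
  move=> Tx Ty.
  have [|| l [m [_ _ -> _ ->]]] :=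
    @on_line e1 (P x 0) e2 (P x y) (QP _ _ Tx T0) Q2 (QP _ _ Tx Ty) Q1.
  - by rewrite brE; ring.
  - by rewrite brE; ring.
  by rewrite X2 Z2 /phi; field; apply: ZP.
have diag x : x \in T -> Y (P x x) = X (P x x).
  move=> Tx.
  have [|| l [m [_ _ -> -> _]]] :=
    @on_line e1 (P 0 0) (P 1 1) (P x x) Qo Qu (QP _ _ Tx Tx) Q1.
  - by rewrite brE; ring.
  - by rewrite brE; ring.
  by rewrite Xo Yo Xu Yu.
have YP x y : x \in T -> y \in T -> Y (P x y) = phi y * Z (P x y).
  move=> Tx Ty.
  have [|| l [m [_ _ _ -> ->]]] :=
    @on_line e2 (P y y) e1 (P x y) (QP _ _ Ty Ty) Q1 (QP _ _ Tx Ty) Q2.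
  - by rewrite brE; ring.
  - by rewrite brE; ring.
  by rewrite diag // XP // Y1 Z1; ring.
have phi0 : phi 0 = 0 by rewrite /phi Xo mul0r.
have phi1 : phi 1 = 1.
  by have := XP 1 1 T1 T1; rewrite Xu Zu mulr1.
exists phi; first split=> // x y Tx Ty Txy.
- have Zd : Z d = 0.
    have [|| l [m [_ _ _ _ ->]]] := @on_line (P 0 0) e1 e2 d Q1 Q2 Qd Qo.
    - by rewrite brE; ring.
    - by rewrite brE; ring.
    by rewrite Z1 Z2; ring.
  have Yd : Y d = X d.
    have [|| l [m [_ _ -> -> _]]] := @on_line e1 (P 0 0) (P 1 1) d Qo Qu Qd Q1.
    - by rewrite brE; ring.
    - by rewrite brE; ring.
    by rewrite Xo Yo Xu Yu.
  (* the line of slope 1 through (0, y) *)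
  have [|| l [m [_ _ Xw Yw Zw]]] :=
    @on_line e1 (P 0 y) d (P x (x + y)) (QP _ _ T0 Ty) Qd (QP _ _ Tx Txy) Q1.
  - by rewrite brE; ring.
  - by rewrite brE; ring.
  apply: (mulIf (ZP _ _ Tx Txy)); rewrite -YP // mulrDl -XP // Xw Yw Zw.
  by rewrite Zd Yd XP // YP // phi0; ring.
- (* the line of slope y through the origin *)
  have [|| l [m [_ _ Xw Yw Zw]]] :=
    @on_line e2 (P 0 0) (P 1 y) (P x (x * y))
      Qo (QP _ _ T1 Ty) (QP _ _ Tx Txy) Q2.
  - by rewrite brE; ring.
  - by rewrite brE; ring.
  apply: (mulIf (ZP _ _ Tx Txy)); rewrite -YP //.
  rewrite -mulrA [phi y * _]mulrC mulrA -XP //.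
  by rewrite Xw Yw Xo Yo XP // YP // phi1; ring.
(* The points (x, 0, 1), e1 and the origin are collinear, so that phi x is
   known up to a constant by the coefficients of their dependency, which are
   in S; comparing with phi 1 = 1 removes the constant. *)
have phiE x : x \in T -> exists2 r, r \in S & phi x = r * (X e1 / Z (P 0 0)).
  move=> Tx.
  have [|| l [m [Sl Sm Xw Yw Zw]]] :=
    @on_line e2 e1 (P 0 0) (P x 0) Q1 Qo (QP _ _ Tx T0) Q2.
  - by rewrite brE; ring.
  - by rewrite brE; ring.
  exists (l / m); first exact: (rpred_div (Sl : l \in S') (Sm : m \in S')).
  have := ZP _ _ Tx T0; rewrite Zw Z1 mulr0 add0r mulf_eq0 negb_or.
  move=> /andP[m0 z0].
  by rewrite /phi Xw Zw Z1 Xo; field; rewrite m0 z0.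
have [r1 Sr1 phi1E] := phiE 1 T1; move=> x /phiE[r Sr ->].
have r10 : r1 != 0.
  apply: contraTneq (oner_neq0 K) => r10.
  by rewrite -phi1 phi1E r10 mul0r eqxx.
have -> : r * (X e1 / Z (P 0 0)) = r / r1.
  by rewrite -[r / r1]mulr1 -phi1 phi1E; field; rewrite r10 ZP.
exact: (rpred_div (Sr : r \in S') (Sr1 : r1 \in S')).
Qed.

(** * The dependency matrix of a grid *)

Lemma kernel_realization (K : fieldType) n (p : 'M[K]_(n, 3)) B (S : {pred K})
    (Q : seq 'rV[K]_3) (idx : 'rV[K]_3 -> 'I_n) :
  same_zeros (circuits p) B -> (\rank B + 3)%N = n ->
  divring_closed S -> (forall i j, B i j \in S) ->
  {in Q, forall q, row (idx q) p = q} ->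
  realization S Q
    (fun f => exists2 x : 'rV[K]_n, x *m B = 0 & forall q, f q = x 0 (idx q)).
Proof.
move=> zerosB rkB Sdiv SB rowp.
have chiE u v w : u \in Q -> v \in Q -> w \in Q ->
    chi p (idx u) (idx v) (idx w) = bracket u v w.
  by move=> Qu Qv Qw; rewrite /chi !rowp.
split=> [u v w z Qu Qv Qw Qz | u v w Qu Qv Qw | u v w Qu Qv Qw].
- rewrite -!chiE // => uvz uvw.
  have [l [m [Sl Sm lm]]] := kernel_line zerosB Sdiv SB uvz uvw.
  by exists l, m; split=> // f [x xB fE]; rewrite !fE; apply: lm.
- rewrite -chiE // => uvw f [x xB fE]; rewrite !fE => xu xv xw q _.
  by rewrite fE (kernel_basis zerosB xB uvw xu xv xw) mxE.
rewrite -chiE // => uvw a b c.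
have [x xB xE] :=
  kernel_interpolation zerosB (\row_k nth 0 [:: a; b; c] k) rkB uvw.
exists (fun q => x 0 (idx q)); split; first by exists x.
- by have := xE ord0; rewrite mxE.
- by have := xE (lift ord0 ord0); rewrite mxE.
- by have := xE ord_max; rewrite mxE.
Qed.

Lemma sign_of_eq0 (R : fieldType) (P : {pred R}) (x y : R) :
  is_positive_cone P -> sign_of P x = sign_of P y -> (x == 0) = (y == 0).
Proof.
case=> _ _ trichotomy; rewrite /sign_of.
by have := (trichotomy x, trichotomy y); case: (x \in P); case: (y \in P);
  case: (- x \in P); case: (- y \in P); case: (x == 0); case: (y == 0) => -[].
Qed.

(** The last row of the matrix is the default value 0 of [nth]; it makes the
    index type inhabited even if [Q] is empty. *)
Lemma point_matrix (K : fieldType) (Q : seq 'rV[K]_3) :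
  exists n (p : 'M[K]_(n.+1, 3)) (idx : 'rV[K]_3 -> 'I_n.+1),
    {in Q, forall q, row (idx q) p = q}.
Proof.
exists (size Q), (\matrix_(i < (size Q).+1) nth 0 Q i),
  (fun q => inord (index q Q)) => q Qq.
by rewrite rowK inordK ?nth_index // ltnS index_size.
Qed.

Theorem theorem4p5 (K : fieldExtType rat) (P : {pred K})
    (hP : is_positive_cone P) :
  exists (n m : nat) (A : 'M[K]_(n, m)),
    [/\ (0 < n)%N, (0 < m)%N, (\rank A + 3)%N = n
      & forall A' : 'M[K]_(n, m),
          \rank A' = \rank A -> sign_pattern P A' = sign_pattern P A ->
          entries_generate A'].
Proof.
have [a gen_a] := primitive_element K.
have [T rootT] := forced_minPoly a.
pose U := [:: 0, 1, a & T].
have [n [p [idx rowp]]] := point_matrix (grid U).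
have [Q1 Q2] : pt 1 0 0 \in grid U /\ pt 0 1 0 \in grid U.
  by rewrite !inE !eqxx ?orbT.
have [U0 U1] : 0 \in U /\ 1 \in U by rewrite !inE !eqxx orbT.
have Qo := mem_grid U0 U0.
have basis : chi p (idx (pt 1 0 0)) (idx (pt 0 1 0)) (idx (pt 0 0 1)) != 0.
  rewrite /chi !rowp // bracket_pt (_ : _ - _ + _ = 1) ?oner_neq0 //.
  by ring.
have rkA := rank_circuits basis.
exists n.+1, #|{: 'I_n.+1 * 'I_n.+1 * 'I_n.+1 * 'I_n.+1}|, (circuits p).
split=> //.
  by apply/card_gt0P; exists (ord0, ord0, ord0, ord0).
move=> B rkB signB S Sdiv SB.
have zerosB : same_zeros (circuits p) B.
  move=> i j; apply: (sign_of_eq0 hP).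
  by have := congr1 (fun M : 'M[sign]_(_, _) => M i j) signB; rewrite !mxE.
have rkB3 : (\rank B + 3)%N = n.+1 by rewrite rkB.
have [phi mphi Sphi] := realization_morphism Sdiv U0 U1
  (kernel_realization zerosB rkB3 Sdiv SB rowp).
have phi_root : root (minPoly 1 a) (phi a).
  by apply/rootT/(partial_morphismW _ mphi) => z Tz; rewrite !inE Tz !orbT.
apply: divring_closed_full phi_root => //.
by apply: Sphi; rewrite !inE eqxx !orbT.
Qed.
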